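(* Let the odd line $M=\mathbb R^{0|1}$ be equipped with a global odd coordinate $\xi$ and the canonical homological vector field $Q=\partial_\xi$. Then, as super vector spaces (even part $\oplus$ odd part, up to isomorphism), $$HC^n_\lambda(\mathbb R^{0|1},\partial_\xi)=\begin{cases}\mathbb R^{0|1}=0\oplus\mathbb R, & n\text{ even},\\ 0=0\oplus 0,& n\text{ odd},\end{cases}$$ for $n=0,1,2,\dots$.
   Context: $C^\infty(\mathbb R^{0|1})=\mathbb R[\xi]$ is the Grassmann algebra on one odd generator: elements are $a+b\xi$ with $a,b\in\mathbb R$, $\xi^2=0$, $\widetilde{1}=0$, $\widetilde{\xi}=1$ (Grassmann parity), and $Q=\partial_\xi$ is the odd derivation with $Q(1)=0$, $Q(\xi)=1$. Derived product: $f\star g := (-1)^{\widetilde f}Q(f)g$ (for homogeneous $f$, extended bilinearly), which is associative. Shifted parity: $\overline f:=\widetilde f+1$. $n$-cochains: $C^n$ is the super vector space of all (even and odd) $\mathbb R$-linear maps $\phi^n: C^\infty(\mathbb R^{0|1})^{\otimes (n+1)}\to\mathbb R$, written $\phi^n(f_0,\dots,f_n)$ and graded by the standard Grassmann parity ($\mathbb R$ being even; a cochain is even/odd if it vanishes on homogeneous tensors of odd/even total standard parity). Shifted cyclic operator: $(\lambda\phi^n)(f_0,\dots,f_n):=(-1)^{n+\overline f_n(\overline f_0+\cdots+\overline f_{n-1})}\phi^n(f_n,f_0,\dots,f_{n-1})$. Derived cyclic cochains: $C^n_\lambda=\{\phi^n\in C^n:\lambda\phi^n=\phi^n\}$. Hochschild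 coboundary: $$(b\phi^n)(f_0,\dots,f_{n+1})=\sum_{i=0}^n(-1)^i\phi^n(f_0,\dots,f_i\star f_{i+1},\dots,f_{n+1})+(-1)^{n+1+\overline f_{n+1}(\overline f_0+\cdots+\overline f_n)}\phi^n(f_{n+1}\star f_0,f_1,\dots,f_n).$$ One has $b^2=0$ and $b(C^n_\lambda)\subset C^{n+1}_\lambda$. The derived cyclic cohomology $HC^n_\lambda(\mathbb R^{0|1},\partial_\xi)$ is the cohomology of the complex $C^0_\lambda\xrightarrow{b}C^1_\lambda\xrightarrow{b}C^2_\lambda\to\cdots$. *)

(* Defs.v *)
From HB Require Import structures.
From mathcomp Require Import all_boot all_order all_algebra.
From mathcomp Require Import all_classical all_reals.
From mathcomp Require Import ring zify.

Set Implicit Arguments.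
Unset Strict Implicit.
Unset Printing Implicit Defensive.

Import Order.TTheory GRing.Theory Num.Theory.
Local Open Scope ring_scope.
Local Open Scope quotient_scope.

(* Parities are booleans: [false] is even, [true] is odd. *)

Section SuperSpace.
Variable R : realType.

Record superspace := SuperSpace {
  scarrier :> lmodType R;
  spart : bool -> scarrier -> Prop;
  spart0 : forall p, spart p 0;
  spartP : forall p a u v, spart p u -> spart p v -> spart p (a *: u + v);
  spart_sum : forall v,
    exists u w, [/\ spart false u, spart true w & v = u + w];
  spart_disj : forall v, spart false v -> spart true v -> v = 0 }.

Definition super_iso (V W : superspace) : Prop :=
  exists h : {linear V -> W},
    bijective h /\ forall p v, spart p v <-> spart p (h v).

Section Standard.
Variables m k : nat.

Definition rpart (p : bool) (x : 'rV[R]_m * 'rV[R]_k) : Prop :=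
  if p then x.1 = 0 else x.2 = 0.

Fact rpart0 p : rpart p 0. Proof. by case: p. Qed.

Fact rpartP p a u v : rpart p u -> rpart p v -> rpart p (a *: u + v).
Proof. by case: p => /= -> ->; rewrite scaler0 addr0. Qed.

Fact rpart_sum v :
  exists u w, [/\ rpart false u, rpart true w & v = u + w].
Proof.
exists (v.1, 0), (0, v.2); split=> //.
by case: v => v1 v2; congr pair; rewrite /= ?addr0 ?add0r.
Qed.

Fact rpart_disj v : rpart false v -> rpart true v -> v = 0.
Proof. by case: v => v1 v2 /= -> ->. Qed.

(* The super vector space R^{m|k}. *)
Definition rsuper : superspace :=
  SuperSpace rpart0 rpartP rpart_sum rpart_disj.

End Standard.
End SuperSpace.

(* R[xi]; the pair (a, b) stands for a + b xi. *)
Definition grass (R : realType) : Type := (R * R)%type.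

Section Grassmann.
Variable R : realType.
Local Notation A := (grass R).

HB.instance Definition _ := GRing.Zmodule.copy A (R * R)%type.

Fact grass_ext (f g : A) : f.1 = g.1 -> f.2 = g.2 -> f = g.
Proof. by case: f g => f1 f2 [g1 g2] /= -> ->. Qed.

Definition gscale (a : R) (f : A) : A := (a * f.1, a * f.2).

Fact gscaleA a b f : gscale a (gscale b f) = gscale (a * b) f.
Proof. by apply: grass_ext => /=; ring. Qed.
Fact gscale1 : left_id 1 gscale.
Proof. by move=> f; apply: grass_ext => /=; ring. Qed.
Fact gscaleDr : right_distributive gscale +%R.
Proof. by move=> a f g; apply: grass_ext => /=; ring. Qed.
Fact gscaleDl f : {morph gscale^~ f : a b / a + b}.
Proof. by move=> a b; apply: grass_ext => /=; ring. Qed.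

HB.instance Definition _ := GRing.Zmodule_isLmodule.Build R A
  gscaleA gscale1 gscaleDr gscaleDl.

Definition gone : A := (1, 0).
Definition gmul (f g : A) : A := (f.1 * g.1, f.1 * g.2 + f.2 * g.1).

Fact gmulA : associative gmul.
Proof. by move=> f g h; apply: grass_ext => /=; ring. Qed.
Fact gmulC : commutative gmul.
Proof. by move=> f g; apply: grass_ext => /=; ring. Qed.
Fact gmul1 : left_id gone gmul.
Proof.
by move=> f; apply: grass_ext => /=; ring.
Qed.
Fact gmulDl : left_distributive gmul +%R.
Proof. by move=> f g h; apply: grass_ext => /=; ring. Qed.
Fact gone_neq0 : gone != 0.
Proof. by apply/eqP => -[/eqP]; rewrite oner_eq0. Qed.

HB.instance Definition _ := GRing.Zmodule_isComNzRing.Build A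
  gmulA gmulC gmul1 gmulDl gone_neq0.

Fact gscalerAl (a : R) (f g : A) : a *: (f * g) = a *: f * g.
Proof.
by apply: grass_ext => /=; ring.
Qed.

HB.instance Definition _ := GRing.Lmodule_isLalgebra.Build R A gscalerAl.

Definition xi : A := (0, 1).
Definition dxi (f : A) : A := (f.2, 0).

Definition ghom (p : bool) (f : A) : Prop := if p then f.1 = 0 else f.2 = 0.
Definition gproj (p : bool) (f : A) : A := if p then (0, f.2) else (f.1, 0).

Fact xi_sqr : xi * xi = 0.
Proof. by apply: grass_ext => /=; ring. Qed.
Fact dxi1 : dxi 1 = 0. Proof. by []. Qed.
Fact dxi_xi : dxi xi = 1. Proof. by []. Qed.

Definition dstar (f g : A) : A :=
  \sum_(p : bool) (-1) ^+ p *: (dxi (gproj p f) * g).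

Fact dstarE f g : dstar f g = - f.2 *: g.
Proof.
rewrite /dstar big_bool /= expr0 expr1 scale1r scaleN1r.
have -> : dxi (f.1, 0) = 0 by [].
by rewrite mul0r addr0; apply: grass_ext => /=; ring.
Qed.

Fact dstar_hom p f g : ghom p f -> dstar f g = (-1) ^+ p *: (dxi f * g).
Proof.
move=> hf; rewrite dstarE; case: p hf => /= hf.
  by apply: grass_ext => /=; ring.
by apply: grass_ext => /=; rewrite hf; ring.
Qed.

End Grassmann.

Section Cochains.
Variable R : realType.
Local Notation A := (grass R).

(* A linear map on the (n+1)-st tensor power of R[xi] is encoded as a
   multilinear function of (f_0, ..., f_n). *)
Definition args (n : nat) : Type := 'I_n.+1 -> A.

Definition upd n (f : args n) (i : 'I_n.+1) (u : A) : args n :=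
  fun j => if j == i then u else f j.

Definition multilinear n (phi : args n -> R^o) : Prop :=
  forall i f (a : R) u v,
    phi (upd f i (a *: u + v)) = a * phi (upd f i u) + phi (upd f i v).

Definition multilinear_pred n : {pred (args n -> R^o)} :=
  fun phi => `[< multilinear phi >].

Arguments multilinear_pred n : clear implicits.

Fact multilinear_submod n : submod_closed (multilinear_pred n).
Proof.
split; first by apply/asboolP => i f a u v /=; rewrite mulr0 addr0.
move=> c phi psi /asboolP hphi /asboolP hpsi; apply/asboolP => i f a u v.
rewrite -![(_ + _) (upd _ _ _)]/(c * _ + _) hphi hpsi; ring.
Qed.
HB.instance Definition _ n :=
  GRing.isSubmodClosed.Build R _ (multilinear_pred n) (multilinear_submod n).

Record cochain n := Cochain {
  cochain_fun :> args n -> R^o;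
  cochainP : cochain_fun \in multilinear_pred n }.

HB.instance Definition _ n := [isSub for @cochain_fun n].
HB.instance Definition _ n := [Choice of cochain n by <:].
HB.instance Definition _ n := [SubChoice_isSubLmodule of cochain n by <:].

Definition cochain_part n (p : bool) (phi : cochain n) : Prop :=
  forall (q : 'I_n.+1 -> bool) (f : args n),
    (forall i, ghom (q i) (f i)) -> odd (\sum_i q i)%N != p -> phi f = 0.

(* Representative in nat of the shifted parity; only its class mod 2 matters. *)
Definition sparity (p : bool) : nat := p.+1.

(* Exponent (shifted parity of f_n) * (sum of the shifted parities of
   f_0, ..., f_{n-1}), where p lists the standard parities. *)
Definition rot_exp n (p : {ffun 'I_n.+1 -> bool}) : nat :=
  (sparity (p ord_max) *
   \sum_(i < n) sparity (p (widen_ord (leqnSn n) i)))%N.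

Definition gprojs n (p : {ffun 'I_n.+1 -> bool}) (f : args n) : args n :=
  fun i => gproj (p i) (f i).

(* (f_n, f_0, ..., f_{n-1}) *)
Definition rotate n (f : args n) : args n := fun j => f (ord_pred j).

(* (f_0, ..., f_i * f_{i+1}, ..., f_{n+1}) with the derived product *)
Definition merge n (i : 'I_n.+1) (f : args n.+1) : args n :=
  fun j => if (j < i)%N then f (widen_ord (leqnSn _) j)
           else if j == i then
             dstar (f (widen_ord (leqnSn _) i)) (f (lift ord0 i))
           else f (lift ord0 j).

(* (f_{n+1} * f_0, f_1, ..., f_n) with the derived product *)
Definition wrap n (f : args n.+1) : args n :=
  fun j => if j == ord0 then dstar (f ord_max) (f ord0)
           else f (widen_ord (leqnSn _) j).

(* Signs depending on parities are only specified on homogeneous arguments;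
   summing over all homogeneous components gives the multilinear extension
   (see [lambda_hom] and [hochb_hom]). *)
Definition lambda_fun n (phi : args n -> R^o) : args n -> R^o := fun f =>
  \sum_(p : {ffun 'I_n.+1 -> bool})
     (-1) ^+ (n + rot_exp p) * phi (rotate (gprojs p f)).

Definition hochb_fun n (phi : args n -> R^o) : args n.+1 -> R^o := fun f =>
  \sum_(i < n.+1) (-1) ^+ i * phi (merge i f) +
  \sum_(p : {ffun 'I_n.+2 -> bool})
     (-1) ^+ (n.+1 + rot_exp p) * phi (wrap (gprojs p f)).

Definition slotwise m n (op : args m -> args n) : Prop :=
  forall k f, exists j (T : A -> A),
    linear T /\ forall u, op (upd f k u) = upd (op f) j (T u).

Fact slotwise_multilinear m n (op : args m -> args n) phi :
  slotwise op -> phi \in multilinear_pred n ->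
  (fun f => phi (op f) : R^o) \in multilinear_pred m.
Proof.
move=> hop /asboolP hphi; apply/asboolP => k f a u v.
have [j [T [Tl opE]]] := hop k f.
by rewrite !opE Tl hphi.
Qed.

Fact slotwise_comp l m n (op1 : args l -> args m) (op2 : args m -> args n) :
  slotwise op1 -> slotwise op2 -> slotwise (fun f => op2 (op1 f)).
Proof.
move=> h1 h2 k f; have [j [T [Tl E]]] := h1 k f.
have [j' [T' [Tl' E']]] := h2 j (op1 f).
exists j', (fun u => T' (T u)); split; first by move=> a u v; rewrite Tl Tl'.
by move=> u; rewrite E E'.
Qed.

Fact idfun_linear : linear (fun u : A => u). Proof. by []. Qed.

Fact gproj_linear p : linear (gproj p : A -> A).
Proof.
by move=> a u v; case: p; apply: grass_ext => /=; ring.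
Qed.

Fact dstar_linearl (g : A) : linear (fun f => dstar f g).
Proof.
move=> a u v; rewrite !dstarE scalerA -scalerDl; congr (_ *: _).
by rewrite /= opprD mulrN.
Qed.

Fact dstar_linearr (f : A) : linear (dstar f).
Proof. by move=> a u v; rewrite !dstarE scalerDr !scalerA mulrC. Qed.

Fact slotwise_gprojs n (p : {ffun 'I_n.+1 -> bool}) : slotwise (gprojs p).
Proof.
move=> k f; exists k, (gproj (p k)); split; first exact: gproj_linear.
move=> u; apply/funext => j; rewrite /gprojs /upd.
by case: eqP => // ->.
Qed.

Fact slotwise_rotate n : slotwise (@rotate n).
Proof.
move=> k f; exists (ordS k), id; split; first exact: idfun_linear.
move=> u; apply/funext => j; rewrite /rotate /upd.
by rewrite -(inj_eq (@ordS_inj _)) ord_predK.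
Qed.

Fact slotwise_merge n (i : 'I_n.+1) : slotwise (merge i).
Proof.
move=> k f.
have wE (j : 'I_n.+1) : (widen_ord (leqnSn _) j == k) = (j == k :> nat)
  by rewrite -val_eqE.
have lE (j : 'I_n.+1) : (lift ord0 j == k) = (j.+1 == k :> nat)
  by rewrite -val_eqE.
case: (ltngtP k i) => [ki|ik|ki].
- have kn : (k < n.+1)%N by rewrite (ltn_trans ki).
  exists (Ordinal kn), id; split; first exact: idfun_linear.
  move=> u; apply/funext => j; rewrite /merge /upd !wE !lE -!val_eqE /=.
  by repeat (case: ifP => ? //); exfalso; lia.
- case: (eqVneq (k : nat) i.+1) => [ki|ki].
    exists i, (fun u => dstar (f (widen_ord (leqnSn _) i)) u).
    split; first exact: dstar_linearr.
    move=> u; apply/funext => j; rewrite /merge /upd !wE !lE -!val_eqE /=.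
    by repeat (case: ifP => ? //); exfalso; lia.
  have kn : (k.-1 < n.+1)%N by have := ltn_ord k; lia.
  exists (Ordinal kn), id; split; first exact: idfun_linear.
  move=> u; apply/funext => j; rewrite /merge /upd !wE !lE -!val_eqE /=.
  by repeat (case: ifP => ? //); exfalso; lia.
- exists i, (fun u => dstar u (f (lift ord0 i))).
  split; first exact: dstar_linearl.
  move=> u; apply/funext => j; rewrite /merge /upd !wE !lE -!val_eqE /=.
  by repeat (case: ifP => ? //); exfalso; lia.
Qed.

Fact slotwise_wrap n : slotwise (@wrap n).
Proof.
move=> k f.
have wE (j : 'I_n.+1) : (widen_ord (leqnSn _) j == k) = (j == k :> nat)
  by rewrite -val_eqE.
case: (eqVneq k ord0) => [->|k0].
  exists ord0, (dstar (f ord_max)); split; first exact: dstar_linearr.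
  move=> u; apply/funext => j; rewrite /wrap /upd -!val_eqE /=.
  by case: eqP.
case: (eqVneq k ord_max) => [->|km].
  exists ord0, (fun u => dstar u (f ord0)); split; first exact: dstar_linearl.
  move=> u; apply/funext => j; rewrite /wrap /upd -!val_eqE /= eqxx.
  by case: eqP => // _; rewrite ltn_eqF.
have kn : (k < n.+1)%N.
  by rewrite ltn_neqAle -ltnS ltn_ord andbT -[n.+1]/(val (@ord_max n.+1)) val_eqE.
exists (Ordinal kn), id; split; first exact: idfun_linear.
move=> u; apply/funext => j; rewrite /wrap /upd wE.
rewrite [ord_max == k]eq_sym (negPf km) [ord0 == k]eq_sym (negPf k0) -!val_eqE /=.
have : (k != 0%N :> nat) by rewrite -[0%N]/(val (@ord0 n.+1)) val_eqE.
by move=> kn0; repeat (case: ifP => ? //); exfalso; lia.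
Qed.

Fact lambda_subproof n (phi : cochain n) :
  lambda_fun phi \in multilinear_pred n.
Proof.
have -> : lambda_fun phi = \sum_(p : {ffun 'I_n.+1 -> bool})
   ((-1) ^+ (n + rot_exp p)) *: (fun f => phi (rotate (gprojs p f)) : R^o).
  by apply/funext => f; rewrite fct_sumE.
apply: rpred_sum => p _; apply: rpredZ.
apply: (slotwise_multilinear (op := fun f => rotate (gprojs p f)));
  last exact: cochainP.
exact: slotwise_comp (@slotwise_gprojs _ p) (@slotwise_rotate n).
Qed.

Definition lambda n (phi : cochain n) : cochain n :=
  Cochain (lambda_subproof phi).

Fact hochb_subproof n (phi : cochain n) :
  hochb_fun phi \in multilinear_pred n.+1.
Proof.
have -> : hochb_fun phi =
   \sum_(i < n.+1) ((-1) ^+ i) *: (fun f => phi (merge i f) : R^o) +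
   \sum_(p : {ffun 'I_n.+2 -> bool})
     ((-1) ^+ (n.+1 + rot_exp p)) *: (fun f => phi (wrap (gprojs p f)) : R^o).
  by apply/funext => f; rewrite -[RHS]/(_ f + _ f) !fct_sumE.
apply: rpredD; apply: rpred_sum => p _; apply: rpredZ.
  exact: slotwise_multilinear (@slotwise_merge _ p) (cochainP phi).
apply: (slotwise_multilinear (op := fun f => wrap (gprojs p f)));
  last exact: cochainP.
exact: slotwise_comp (@slotwise_gprojs _ p) (@slotwise_wrap n).
Qed.

Definition hochb n (phi : cochain n) : cochain n.+1 :=
  Cochain (hochb_subproof phi).

Fact lambda_linear n : linear (@lambda n).
Proof.
move=> a phi psi; apply/val_inj/funext => f.
rewrite -[RHS]/(a * lambda_fun phi f + lambda_fun psi f) /=.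
rewrite mulr_sumr -big_split /=; apply: eq_bigr => p _.
by rewrite [in RHS]mulrCA -mulrDr.
Qed.

Fact hochb_linear n : linear (@hochb n).
Proof.
move=> a phi psi; apply/val_inj/funext => f.
rewrite -[RHS]/(a * hochb_fun phi f + hochb_fun psi f) /= /hochb_fun.
rewrite mulrDr addrACA !mulr_sumr -!big_split /=.
by congr (_ + _); apply: eq_bigr => p _; rewrite [in RHS]mulrCA -mulrDr.
Qed.

HB.instance Definition _ n :=
  GRing.isLinear.Build R (cochain n) (cochain n) _ (@lambda n) (@lambda_linear n).
HB.instance Definition _ n :=
  GRing.isLinear.Build R (cochain n) (cochain n.+1) _ (@hochb n) (@hochb_linear n).

Fact cochain_upd n (phi : cochain n) i f a u v :
  phi (upd f i (a *: u + v)) = a * phi (upd f i u) + phi (upd f i v).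
Proof. by have /asboolP := cochainP phi; apply. Qed.

Fact upd_id n (f : args n) i : upd f i (f i) = f.
Proof. by apply/funext => j; rewrite /upd; case: eqP => // ->. Qed.

Fact cochain_upd0 n (phi : cochain n) i f : phi (upd f i 0) = 0.
Proof.
have := cochain_upd phi i f (-1) 0 0.
by rewrite scaler0 addr0 mulN1r addNr.
Qed.

Fact cochain_updZ n (phi : cochain n) i f a u :
  phi (upd f i (a *: u)) = a * phi (upd f i u).
Proof. by have := cochain_upd phi i f a u 0; rewrite addr0 cochain_upd0 addr0. Qed.

Fact cochain_zero n (phi : cochain n) f i : f i = 0 -> phi f = 0.
Proof. by move=> fi; rewrite -(upd_id f i) fi cochain_upd0. Qed.

Fact gproj_hom p q (f : A) : ghom q f -> gproj p f = if p == q then f else 0.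
Proof. by case: p q f => -[] [f1 f2] /= ->. Qed.

Fact gprojs_hom n (q p : {ffun 'I_n.+1 -> bool}) (f : args n) :
  (forall i, ghom (q i) (f i)) -> p = q -> gprojs p f = f.
Proof.
by move=> hf ->; apply/funext => i; rewrite /gprojs (gproj_hom _ (hf i)) eqxx.
Qed.

Fact gprojs_hom0 n (q p : {ffun 'I_n.+1 -> bool}) (f : args n) :
  (forall i, ghom (q i) (f i)) -> p != q -> exists i, gprojs p f i = 0.
Proof.
move=> hf /eqP pq; have [i pqi] : exists i, p i != q i.
  apply/existsP; rewrite -negb_forall; apply/negP => /forallP h; apply: pq.
  by apply/ffunP => i; apply/eqP.
by exists i; rewrite /gprojs (gproj_hom _ (hf i)) (negPf pqi).
Qed.

Fact lambda_hom n (phi : cochain n) (q : {ffun 'I_n.+1 -> bool}) f :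
  (forall i, ghom (q i) (f i)) ->
  lambda phi f = (-1) ^+ (n + rot_exp q) * phi (rotate f).
Proof.
move=> hf; rewrite /= /lambda_fun (bigD1 q) //= (gprojs_hom hf) // big1 ?addr0 //.
move=> p pq; have [i fi] := gprojs_hom0 hf pq.
rewrite (@cochain_zero _ _ _ (ordS i)) ?mulr0 //.
by rewrite /rotate ordSK.
Qed.

Fact dstar0l (g : A) : dstar 0 g = 0.
Proof. by rewrite dstarE oppr0 scale0r. Qed.
Fact dstar0r (f : A) : dstar f 0 = 0.
Proof. by rewrite dstarE scaler0. Qed.

Fact hochb_hom n (phi : cochain n) (q : {ffun 'I_n.+2 -> bool}) f :
  (forall i, ghom (q i) (f i)) ->
  hochb phi f = \sum_(i < n.+1) (-1) ^+ i * phi (merge i f) +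
                (-1) ^+ (n.+1 + rot_exp q) * phi (wrap f).
Proof.
move=> hf; rewrite /= /hochb_fun; congr (_ + _).
rewrite (bigD1 q) //= (gprojs_hom hf) // big1 ?addr0 //.
move=> p pq; have [i fi] := gprojs_hom0 hf pq.
have [j wj] : exists j, wrap (gprojs p f) j = 0.
  case: (unliftP ord_max i) => [j|] iE; last first.
    by exists ord0; rewrite /wrap eqxx -iE fi dstar0l.
  have iE' : i = widen_ord (leqnSn _) j.
    by apply: val_inj; rewrite iE /= /bump leqNgt ltn_ord.
  exists j; rewrite /wrap; case: eqP => [j0|_]; last by rewrite -iE'.
  have -> : ord0 = i by rewrite iE' j0; apply: val_inj.
  by rewrite fi dstar0r.
by rewrite (cochain_zero _ wj) mulr0.
Qed.

Definition ginv (f : A) : A := (f.1, - f.2).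

Fact ginv_linear : linear ginv.
Proof.
by move=> a u v; apply: grass_ext => /=; ring.
Qed.

Fact ginv_hom p (f : A) : ghom p f -> ginv f = (-1) ^+ p *: f.
Proof.
by case: p f => -[f1 f2] /= ->; apply: grass_ext => /=; ring.
Qed.

Fact ginv_gproj p (f : A) : gproj p (ginv f) = ginv (gproj p f).
Proof. by case: p; apply: grass_ext => /=; ring. Qed.

Fact ginv_dstar (f g : A) : dstar (ginv f) (ginv g) = - ginv (dstar f g).
Proof.
by rewrite !dstarE; apply: grass_ext => /=; ring.
Qed.

Definition ginvs n (f : args n) : args n := fun i => ginv (f i).

Fact slotwise_ginvs n : slotwise (@ginvs n).
Proof.
move=> k f; exists k, ginv; split; first exact: ginv_linear.
by move=> u; apply/funext => j; rewrite /ginvs /upd; case: eqP.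
Qed.

Definition grading n (phi : cochain n) : cochain n :=
  Cochain (slotwise_multilinear (@slotwise_ginvs n) (cochainP phi)).

Fact grading_linear n : linear (@grading n).
Proof. by move=> a phi psi; apply/val_inj/funext => f. Qed.
HB.instance Definition _ n :=
  GRing.isLinear.Build R (cochain n) (cochain n) _ (@grading n) (@grading_linear n).

Fact lambda_grading n (phi : cochain n) :
  lambda (grading phi) = grading (lambda phi).
Proof.
apply/val_inj/funext => f; rewrite /= /lambda_fun; apply: eq_bigr => p _ /=.
congr (_ * phi _); apply/funext => j.
by rewrite /ginvs /rotate /gprojs ginv_gproj.
Qed.

Fact cochain_opp_slot n (phi : cochain n) f g j :
  g = upd f j (- f j) -> phi f = - phi g.
Proof.
by move=> ->; rewrite -(scaleN1r (f j)) cochain_updZ upd_id mulN1r opprK.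
Qed.

Fact hochb_grading n (phi : cochain n) :
  hochb (grading phi) = - grading (hochb phi).
Proof.
apply/val_inj/funext => f.
rewrite -[RHS]/(- hochb_fun phi (ginvs f)) /= /hochb_fun opprD -!sumrN.
congr (_ + _); apply: eq_bigr => p _ /=; rewrite -mulrN; congr (_ * _).
  apply: (@cochain_opp_slot _ _ _ _ p); apply/funext => j.
  rewrite /ginvs /merge /upd ltnn eqxx ginv_dstar.
  by case: (eqVneq j p) => [->|_]; [rewrite ltnn | case: ifP].
apply: (@cochain_opp_slot _ _ _ _ ord0); apply/funext => j.
rewrite /ginvs /wrap /upd /gprojs eqxx !ginv_gproj ginv_dstar.
by case: eqP.
Qed.

Fact cochain_scale n (phi : cochain n) (q : 'I_n.+1 -> bool) f :
  phi (fun i => (-1) ^+ (q i) *: f i) = (-1) ^+ (\sum_i q i)%N * phi f.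
Proof.
suff H k : (k <= n.+1)%N ->
    phi (fun i => if (i < k)%N then (-1) ^+ (q i) *: f i else f i) =
    (-1) ^+ (\sum_(i < n.+1 | (i < k)%N) q i)%N * phi f.
  have := H _ (leqnn _).
  rewrite [X in _ ^+ X](eq_bigl xpredT) => [<-|i]; last by rewrite ltn_ord.
  by congr (phi _); apply/funext => i; rewrite ltn_ord.
elim: k => [_|k IH kn].
  by rewrite big_pred0 // expr0 mul1r.
pose i := Ordinal kn.
rewrite (bigD1 i) ?ltnS //= exprD -mulrA.
have -> : (\sum_(j < n.+1 | (j < k.+1)%N && (j != i)) q j =
           \sum_(j < n.+1 | (j < k)%N) q j)%N.
  by apply: eq_bigl => j; rewrite ltnS [RHS]ltn_neqAle andbC -val_eqE.
rewrite -(IH (ltnW kn)); 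
pose g : args n := fun j => if (j < k)%N then (-1) ^+ q j *: f j else f j.
rewrite -[in RHS]/g.
have gi : g i = f i by rewrite /g /= ltnn.
rewrite -[in RHS](upd_id g i) gi -cochain_updZ; congr (phi _).
apply/funext => j; rewrite /upd /g -val_eqE /= ltnS leq_eqVlt.
by case: eqP => //= jk; have -> : j = i by apply: val_inj.
Qed.

Fact cochain_eq0 n (phi : cochain n) :
  (forall (q : 'I_n.+1 -> bool) f, (forall i, ghom (q i) (f i)) -> phi f = 0) ->
  phi = 0.
Proof.
move=> h; apply/val_inj/funext => f.
rewrite -[RHS]/(0 : R).
suff H k : (k <= n.+1)%N -> forall g : args n,
    (forall i : 'I_n.+1, (k <= i)%N -> exists p, ghom p (g i)) -> phi g = 0.
  by apply: (H n.+1) => // i; rewrite leqNgt ltn_ord.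
elim: k {f} => [|k IH] kn f hf.
  have [q hq] := boolp.choice (fun i => hf i isT).
  exact: h hq.
pose i := Ordinal kn.
have fE : f = upd f i (1 *: gproj false (f i) + gproj true (f i)).
  rewrite -{1}(upd_id f i) scale1r; congr upd.
  by apply: grass_ext => /=; ring.
have aux b : phi (upd f i (gproj b (f i))) = 0.
  apply: (IH (ltnW kn)) => j kj; rewrite /upd; case: eqP => [_|ji].
    by exists b; case: b.
  apply: hf; rewrite ltn_neqAle kj andbT; apply/eqP => E; apply: ji.
  by apply: val_inj.
by rewrite fE cochain_upd !aux mulr0 addr0.
Qed.

Fact grading_hom n (phi : cochain n) (q : 'I_n.+1 -> bool) f :
  (forall i, ghom (q i) (f i)) ->
  grading phi f = (-1) ^+ (\sum_i q i)%N * phi f.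
Proof.
move=> hf; rewrite -cochain_scale /=; congr (phi _); apply/funext => i.
exact: ginv_hom.
Qed.

Fact grading_part n p (phi : cochain n) :
  cochain_part p phi -> grading phi = (-1) ^+ p *: phi.
Proof.
move=> hphi; apply/eqP; rewrite -subr_eq0; apply/eqP; apply: cochain_eq0.
move=> q f hf.
rewrite -[LHS]/(grading phi f - (-1) ^+ p * phi f) (grading_hom _ hf).
have [<-|/hphi->//] := eqVneq (odd (\sum_i q i)%N) p; last by rewrite !mulr0 subr0.
by rewrite signr_odd subrr.
Qed.

Definition hcomp n p (phi : cochain n) : cochain n :=
  2^-1 *: (phi + (-1) ^+ p *: grading phi).

Fact hcomp_part n p (phi : cochain n) : cochain_part p (hcomp p phi).
Proof.
move=> q f hf hq.
rewrite -[LHS]/(2^-1 * (phi f + (-1) ^+ p * grading phi f)) (grading_hom _ hf).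
rewrite -(signr_odd _ (\sum_i q i)); case: (odd _) p hq => -[] // _ /=; ring.
Qed.

Fact hcomp_sum n (phi : cochain n) : phi = hcomp false phi + hcomp true phi.
Proof.
rewrite /hcomp -scalerDr expr0 expr1 scale1r scaleN1r addrACA subrr addr0.
rewrite -mulr2n -scaler_nat scalerA mulVf ?scale1r //.
by rewrite pnatr_eq0.
Qed.

Fact cochain_part0 n p : cochain_part p (0 : cochain n). Proof. by []. Qed.

Fact cochain_partP n p a (phi psi : cochain n) :
  cochain_part p phi -> cochain_part p psi -> cochain_part p (a *: phi + psi).
Proof.
move=> h1 h2 q f hf hq; rewrite -[LHS]/(a * phi f + psi f).
by rewrite (h1 q) // (h2 q) // mulr0 addr0.
Qed.

Fact cochain_part_sum n (v : cochain n) :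
  exists u w, [/\ cochain_part false u, cochain_part true w & v = u + w].
Proof.
exists (hcomp false v), (hcomp true v); split; try exact: hcomp_part.
exact: hcomp_sum.
Qed.

Fact cochain_part_disj n (v : cochain n) :
  cochain_part false v -> cochain_part true v -> v = 0.
Proof.
move=> h0 h1; apply: cochain_eq0 => q f hf.
have [E|E] := eqVneq (odd (\sum_i q i)%N) false; last exact: h0 E.
by apply: h1 hf _; rewrite E.
Qed.

Definition cochain_super n : superspace R :=
  SuperSpace (@cochain_part0 n) (@cochain_partP n)
    (@cochain_part_sum n) (@cochain_part_disj n).

End Cochains.

Section CyclicCohomology.
Variable R : realType.
Local Notation cochain := (cochain R).

Definition cyclic n (phi : cochain n) : Prop := lambda phi = phi.

Definition cocycle_pred n : {pred cochain n} :=
  fun phi => `[< cyclic phi /\ hochb phi = 0 >].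

Arguments cocycle_pred n : clear implicits.

Fact cocycle_submod n : submod_closed (cocycle_pred n).
Proof.
split; first by apply/asboolP; rewrite /cyclic !linear0.
move=> a u v /asboolP[cu bu] /asboolP[cv bv]; apply/asboolP.
by rewrite /cyclic !linearP /= bu bv cu cv scaler0 addr0.
Qed.
HB.instance Definition _ n :=
  GRing.isSubmodClosed.Build R _ (cocycle_pred n) (cocycle_submod n).

Record cocycle n := Cocycle {
  cocycle_val :> cochain n;
  cocycleP : cocycle_val \in cocycle_pred n }.

HB.instance Definition _ n := [isSub for @cocycle_val n].
HB.instance Definition _ n := [Choice of cocycle n by <:].
HB.instance Definition _ n := [SubChoice_isSubLmodule of cocycle n by <:].

Definition is_coboundary n : cochain n -> Prop :=
  if n is m.+1 then
    fun phi => exists2 psi : cochain m, cyclic psi & hochb psi = phi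
  else fun phi => phi = 0.

Definition coboundary_pred n : {pred cocycle n} :=
  fun z => `[< is_coboundary (cocycle_val z) >].

Arguments coboundary_pred n : clear implicits.

Fact is_coboundaryP n a (u v : cochain n) :
  is_coboundary u -> is_coboundary v -> is_coboundary (a *: u + v).
Proof.
case: n u v => [|m] u v /=; first by move=> -> ->; rewrite scaler0 addr0.
move=> [x cx <-] [y cy <-]; exists (a *: x + y); last by rewrite linearP.
by rewrite /cyclic linearP /= cx cy.
Qed.

Fact is_coboundary0 n : is_coboundary (0 : cochain n).
Proof. by case: n => //= m; exists 0; rewrite /cyclic !linear0. Qed.

Fact coboundary_submod n : submod_closed (coboundary_pred n).
Proof.
split; first by apply/asboolP; apply: is_coboundary0.
by move=> a u v /asboolP hu /asboolP hv; apply/asboolP; apply: is_coboundaryP.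
Qed.
HB.instance Definition _ n :=
  GRing.isSubmodClosed.Build R _ (coboundary_pred n) (coboundary_submod n).

Definition HC n : Type := Quotient.quot (coboundary_pred n).

HB.instance Definition _ n := GRing.Zmodule.on (HC n).

Definition HC_class n (z : cocycle n) : HC n := \pi_(HC n) z.

Fact HC_classE n (x y : cocycle n) :
  HC_class x = HC_class y <-> is_coboundary (cocycle_val x - cocycle_val y).
Proof.
have E := Quotient.idealrBE (coboundary_pred n) x y.
split=> [xy|xy].
  by have /asboolP : x - y \in coboundary_pred n by rewrite E; apply/eqP.
by apply/eqP; rewrite /HC_class -E; apply/asboolP.
Qed.

Fact HC_classD n (x y : cocycle n) : HC_class (x + y) = HC_class x + HC_class y.
Proof. by rewrite /HC_class raddfD. Qed.

Fact HC_class_ex n (c : HC n) : exists z, c = HC_class z.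
Proof. by exists (repr c); rewrite /HC_class reprK. Qed.

Definition HC_scale n (a : R) (c : HC n) : HC n := HC_class (a *: repr c).

Fact HC_classZ n a (z : cocycle n) : HC_class (a *: z) = HC_scale a (HC_class z).
Proof.
apply/HC_classE.
have /HC_classE h : HC_class z = HC_class (repr (HC_class z)).
  by rewrite {2}/HC_class reprK.
have := is_coboundaryP a h (is_coboundary0 _).
by rewrite addr0 scalerBr.
Qed.

Fact HC_scaleA n a b (v : HC n) : HC_scale a (HC_scale b v) = HC_scale (a * b) v.
Proof. by case: (HC_class_ex v) => z ->; rewrite -!HC_classZ scalerA. Qed.
Fact HC_scale1 n : left_id 1 (@HC_scale n).
Proof. by move=> v; case: (HC_class_ex v) => z ->; rewrite -!HC_classZ scale1r. Qed.
Fact HC_scaleDr n : right_distributive (@HC_scale n) +%R.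
Proof.
move=> a u v; case: (HC_class_ex u) => x ->; case: (HC_class_ex v) => y ->.
by rewrite -(HC_classD x y) -!HC_classZ -(HC_classD (a *: x)) scalerDr.
Qed.
Fact HC_scaleDl n (v : HC n) : {morph (@HC_scale n)^~ v : a b / a + b}.
Proof.
move=> a b; case: (HC_class_ex v) => x ->.
by rewrite -!HC_classZ -(HC_classD (a *: x)) scalerDl.
Qed.

HB.instance Definition _ n := GRing.Zmodule_isLmodule.Build R (HC n)
  (@HC_scaleA n) (@HC_scale1 n) (@HC_scaleDr n) (@HC_scaleDl n).

Definition HC_part n (p : bool) (c : HC n) : Prop :=
  exists2 z : cocycle n, cochain_part p (cocycle_val z) & c = HC_class z.

Fact HC_part0 n p : HC_part p (0 : HC n).
Proof. by exists 0 => //; rewrite /HC_class raddf0. Qed.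

Fact HC_partP n p a (u v : HC n) :
  HC_part p u -> HC_part p v -> HC_part p (a *: u + v).
Proof.
move=> [x hx ->] [y hy ->]; exists (a *: x + y); first exact: cochain_partP.
by rewrite HC_classD HC_classZ.
Qed.

Fact cocycle_hcomp n p (z : cocycle n) : hcomp p z \in cocycle_pred n.
Proof.
apply/asboolP; have /asboolP[cz bz] := cocycleP z; split.
  rewrite /cyclic /hcomp linearZ linearD linearZ /= cz lambda_grading.
  by rewrite [lambda z]cz.
by rewrite /hcomp linearZ linearD linearZ /= hochb_grading bz linear0 oppr0
  scaler0 addr0 scaler0.
Qed.

Fact HC_part_sum n (v : HC n) :
  exists u w, [/\ HC_part false u, HC_part true w & v = u + w].
Proof.
have [z ->] := HC_class_ex v.
exists (HC_class (Cocycle (cocycle_hcomp false z))),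
       (HC_class (Cocycle (cocycle_hcomp true z))); split.
- by eexists; [|reflexivity]; apply: hcomp_part.
- by eexists; [|reflexivity]; apply: hcomp_part.
rewrite -HC_classD; congr HC_class; apply: val_inj; exact: hcomp_sum.
Qed.

Fact is_coboundary_grading n (u : cochain n) :
  is_coboundary u -> is_coboundary (grading u).
Proof.
case: n u => [|m] u /=; first by move=> ->; rewrite linear0.
move=> [x cx <-]; exists (- grading x).
  by rewrite /cyclic linearN /= lambda_grading cx.
by rewrite linearN /= hochb_grading opprK.
Qed.

Fact HC_part_disj n (v : HC n) : HC_part false v -> HC_part true v -> v = 0.
Proof.
move=> [x hx ->] [y hy /HC_classE h].
have -> : 0 = HC_class (0 : cocycle n) by rewrite /HC_class raddf0.
apply/HC_classE; rewrite -[cocycle_val 0]/(0 : cochain n) subr0.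
have := is_coboundary_grading h.
rewrite linearB /= (grading_part hx) (grading_part hy) expr0 expr1 scale1r.
rewrite scaleN1r opprK => h'.
have := is_coboundaryP 2^-1 (is_coboundaryP 1 h h') (is_coboundary0 n).
rewrite scale1r addr0 addrACA addNr addr0 -mulr2n -scaler_nat scalerA.
by rewrite mulVf ?pnatr_eq0 // scale1r.
Qed.

(* HC^n with the grading induced by the standard parity of cochains *)
Definition HC_super n : superspace R :=
  SuperSpace (@HC_part0 n) (@HC_partP n) (@HC_part_sum n) (@HC_part_disj n).

End CyclicCohomology.

(* Main.v *)
(** Put e = - xi and u = 1.  The derived product is e * e = e, e * u = u,
    u * e = u * u = 0, and for the shifted parity e is even and u is odd.  A
    cochain is determined by its values on words in e and u, on which the
    coboundary reads (b F)(w) = sum_i (-1)^i [w_i = e] F(w without w_i): the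
    wrap-around term is the last term of this sum, without any further sign.
    The derivation counting the letters u is the inner derivation [e, -], so it
    acts trivially on cyclic cohomology.  Explicitly, inserting e with
    alternating signs at every place except the front gives an operator K
    preserving cyclicity with b K + K b = (number of letters u).  Dividing by
    that number, only the value on the word e...e survives.  On it, cyclicity
    forces the value 0 for odd n; for even n it is free, of odd parity, and no
    coboundary reaches it. *)

From HB Require Import structures.
Require Import Defs.
From mathcomp Require Import all_boot all_order all_algebra.
From mathcomp Require Import all_classical all_reals.
From mathcomp Require Import ring zify.

Set Implicit Arguments.
Unset Strict Implicit.
Unset Printing Implicit Defensive.

Import Order.TTheory GRing.Theory Num.Theory.
Local Open Scope ring_scope.

(* [true] stands for e = - xi and [false] for u = 1; a cochain of degree n only
   sees the first n.+1 letters. *)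
Definition word := nat -> bool.

(** * Deletion, insertion and rotation of letters *)

Definition wdel (i : nat) (w : word) : word := fun k => w (bump i k).

Definition wins (j : nat) (w : word) : word :=
  fun k => if (k < j)%N then w k else (k == j) || w k.-1.

Definition wrot (n : nat) (w : word) : word :=
  fun k => if k == 0%N then w n else w k.-1.

Lemma wdel_ins j w : wdel j (wins j w) = w.
Proof.
apply/funext => k; rewrite /wdel /wins /bump.
by case: (ltnP k j) => kj; repeat (case: ifP => ?; try by exfalso; lia);
  rewrite ?add0n ?add1n //=; case: eqP => //; lia.
Qed.

(** Simplicial identities: [bump j i] is the place that letter [i] of [w] takes after the insertion,
    so deleting it commutes with the insertion up to a shift. *)
Lemma wdel_bump_ins i j w :
  wdel (bump j i) (wins j w) =
  if (j <= i)%N then wins j (wdel i w) else wins j.-1 (wdel i w).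
Proof.
case: leqP => ij; apply/funext => k; rewrite /wdel /wins /bump.
all: case: (ltngtP k j) => kj; case: (ltngtP k j.-1) => kj';
  case: (ltngtP k i) => ki; try (by exfalso; lia).
all: by repeat (match goal with
  | |- context [if ?b then _ else _] => case: (boolP b) => ?
  | |- context [?a == ?b] => case: (eqVneq a b) => ?
  end); try (by exfalso; lia); rewrite //=; congr w; lia.
Qed.

Lemma wins_del i (w : word) : w i -> wins i (wdel i w) = w.
Proof.
move=> wi; apply/funext => k; rewrite /wdel /wins /bump.
case: (ltngtP k i) => ki //; last by rewrite ki wi.
by rewrite /= (_ : (i <= k.-1)%N) ?add1n ?prednK //; lia.
Qed.

Lemma wins_rot n j (w : word) :
  (j <= n)%N -> wins j.+1 (wrot n w) = wrot n.+1 (wins j w).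
Proof.
move=> jn; apply/funext => -[|k]; rewrite /wins /wrot /= ?ltnS.
  by case: (ltngtP n.+1 j) => //; lia.
rewrite eqSS; case: ltngtP => // ki; by case: k ki.
Qed.

(** * The homotopy formula on words *)

Section Homotopy.
Variable R : comPzRingType.
Implicit Types (F : word -> R) (w : word).

(** In [wb m F w] and [wK m F w] the word [w] counts as having [m] letters, while [F] is applied to
    words of [m - 1] and [m + 1] letters respectively. *)
Definition wb m F w : R :=
  \sum_(i < m) (-1) ^+ i * ((w i)%:R * F (wdel i w)).

Definition wK m F w : R := \sum_(j < m) (-1) ^+ j.+1 * F (wins j.+1 w).

Definition wweight m w : nat := \sum_(i < m) ~~ w i.

(** Below [i] the two sums cancel index by index; from [i] on, each term of the first cancels the
    next term of the second, leaving index [i] of the second. *)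
Lemma alternating_telescope i d (g : nat -> R) :
  \sum_(j < i + d) (-1) ^+ j.+1 * g j.+1 +
  \sum_(j < (i + d).+1) (-1) ^+ j.+1 * (if (j < i)%N then - g j.+1 else g j) =
  - ((-1) ^+ i * g i).
Proof.
elim: d => [|d IH].
  rewrite addn0 big_ord_recr /= ltnn addrA -big_split /= big1 ?add0r.
    by rewrite exprS mulN1r mulNr.
  by move=> j _; rewrite ltn_ord mulrN subrr.
rewrite addnS big_ord_recr [X in _ + X]big_ord_recr /=.
rewrite addrACA IH ltnNge -addnS leq_addr /=.
by rewrite addnS [in X in _ + (_ + X)]exprS mulN1r mulNr subrr addr0.
Qed.

(** Deleting the inserted e restores [w]. A letter behind the insertion sits one place further on,
    whence its minus sign. *)
Lemma wb_ins m j F w : (j <= m)%N ->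
  wb m.+1 F (wins j w) =
  (-1) ^+ j * F w +
  \sum_(i < m) (-1) ^+ i * ((w i)%:R *
     (if (j <= i)%N then - F (wins j (wdel i w))
      else F (wins j.-1 (wdel i w)))).
Proof.
move=> jm; have jm1 : (j < m.+1)%N by [].
rewrite /wb (bigD1_ord (Ordinal jm1)) //= wdel_ins {1}/wins ltnn eqxx /= mul1r.
congr (_ + _); apply: eq_bigr => i _.
rewrite -[wins j w (bump j i)]/(wdel j (wins j w) i) wdel_ins wdel_bump_ins.
rewrite /bump; case: leqP => _ //.
by rewrite add1n exprS mulN1r !mulrN mulNr.
Qed.

(* The sum over [j] of the insertions telescopes to the term [j = i], which
   puts back the letter removed by [wdel i]. *)
Lemma wb_wK m F w :
  wb m (wK m.-1 F) w + wK m (wb m.+1 F) w = (wweight m w)%:R * F w.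
Proof.
case: m => [|m]; first by rewrite /wb /wK /wweight !big_ord0 addr0 mul0r.
have KbE : wK m.+1 (wb m.+2 F) w =
    \sum_(i < m.+1) (F w + (-1) ^+ i * ((w i)%:R *
      \sum_(j < m.+1) (-1) ^+ j.+1 *
        (if (j < i)%N then - F (wins j.+1 (wdel i w))
         else F (wins j (wdel i w))))).
  rewrite big_split /=.
  under [X in _ + X]eq_bigr do rewrite !mulr_sumr.
  rewrite exchange_big -big_split; apply: eq_bigr => j _ /=.
  rewrite wb_ins // mulrDr mulrA -expr2 sqrr_sign mul1r; congr (_ + _).
  rewrite mulr_sumr; apply: eq_bigr => i _.
  by rewrite mulrCA (mulrCA (w i)%:R).
rewrite KbE -big_split /wweight natr_sum mulr_suml; apply: eq_bigr => i _.
rewrite /= addrCA -!mulrDr /wK.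
have im : (i <= m)%N by rewrite -ltnS.
have := alternating_telescope i (m - i) (fun j => F (wins j (wdel i w))).
rewrite subnKC // => ->.
(* A letter u keeps its copy of [F w]; for a letter e the telescoped term cancels it. *)
case wi : (w i); last by rewrite mul0r mulr0 addr0 mul1r.
by rewrite wins_del // mul1r mulrN mulrA -expr2 sqrr_sign mul1r subrr mul0r.
Qed.

End Homotopy.

(* Only u is odd for the shifted parity. *)
Definition wrot_odd n (w : word) : bool := ~~ w n && odd (wweight n w).

Lemma wweight_ins m j (w : word) : (j <= m)%N ->
  wweight m.+1 (wins j w) = wweight m w.
Proof.
move=> jm; have jm1 : (j < m.+1)%N by [].
rewrite /wweight (bigD1_ord (Ordinal jm1)) //= {1}/wins ltnn eqxx add0n.
by apply: eq_bigr => i _; rewrite -[wins j w _]/(wdel j (wins j w) i) wdel_ins.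
Qed.

Lemma wrot_odd_last n (w : word) : w n -> wrot_odd n w = false.
Proof. by rewrite /wrot_odd => ->. Qed.

Lemma wrot_odd_ins n j (w : word) : (j <= n)%N ->
  wrot_odd n.+1 (wins j w) = wrot_odd n w.
Proof.
move=> jn; rewrite /wrot_odd wweight_ins //; congr (~~ _ && _).
by rewrite /wins [in LHS]ltnNge (leq_trans jn) //= gtn_eqF.
Qed.

Lemma wweight_rot n (w : word) : wweight n.+1 (wrot n w) = wweight n.+1 w.
Proof. by rewrite /wweight big_ord_recl big_ord_recr addnC. Qed.

Lemma wweight_del m i (w : word) : (i <= m)%N -> w i ->
  wweight m (wdel i w) = wweight m.+1 w.
Proof.
move=> im wi; have im1 : (i < m.+1)%N by [].
by rewrite /wweight [RHS](bigD1_ord (Ordinal im1)) //= wi.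
Qed.

Lemma wweight_eq0 m (w : word) :
  wweight m w = 0%N -> forall k, (k < m)%N -> w k.
Proof.
move=> /eqP; rewrite /wweight sum_nat_eq0 => /forallP wt k km.
by have := wt (Ordinal km); rewrite /= eqb0 negbK.
Qed.

(** * Cyclic functions on words *)

Section CyclicWords.
Variable R : comPzRingType.
Implicit Types F : word -> R.

(** Words are infinite, so this condition singles out the functions that come from cochains with [m]
    arguments. *)
Definition wlocal m F :=
  forall w w' : word, (forall k, (k < m)%N -> w k = w' k) -> F w = F w'.

Definition wcyclic n F :=
  forall w, (-1) ^+ (n + wrot_odd n w) * F (wrot n w) = F w.

(** Rotating moves the insertion places from 1, ..., n+1 to 0, ..., n. Cyclicity of [F] then trades
    place 0 for place n+1. *)
Lemma wK_cyclic n F : wlocal n.+2 F -> wcyclic n.+1 F ->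
  wcyclic n (wK n.+1 F).
Proof.
move=> locF cycF w.
have rotE j : (j <= n)%N -> F (wrot n.+1 (wins j w)) =
    (-1) ^+ (n.+1 + wrot_odd n w) * F (wins j w).
  by move=> jn; rewrite -[in RHS]cycF wrot_odd_ins // mulrA -expr2 sqrr_sign mul1r.
(* Inserting e in front is rotating an e inserted at the end; e is even for the shifted parity, so
   only the sign of the degree appears. *)
have lastE : F (wins 0 w) = (-1) ^+ n.+1 * F (wins n.+1 w).
  rewrite -[in RHS]cycF wrot_odd_last; last by rewrite /wins ltnn eqxx.
  rewrite addn0 mulrA -expr2 sqrr_sign mul1r.
  apply: locF => -[|k] kn; rewrite /wins /wrot //=.
    by rewrite ltnn eqxx.
  by rewrite -ltnS kn.
rewrite /wK mulr_sumr.
transitivity (\sum_(j < n.+1) (-1) ^+ j * F (wins j w)).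
  apply: eq_bigr => j _; have jn : (j <= n)%N by rewrite -ltnS.
  rewrite wins_rot // rotE // mulrCA addSn !exprS !mulN1r !mulNr !mulrN.
  by rewrite opprK signrMK.
rewrite big_ord_recl [RHS]big_ord_recr /= expr0 mul1r lastE addrC.
by congr (_ + _); apply: eq_bigr.
Qed.

End CyclicWords.

(** * Cochains as functions on words *)

Section Evaluation.
Variable R : realType.
Local Notation A := (grass R).

Definition letter (b : bool) : A := if b then (0, -1) else (1, 0).

Definition wargs n (w : word) : args R n := fun i => letter (w i).

Definition weval n (phi : cochain R n) (w : word) : R := phi (@wargs n w).

(** The code of a letter is its standard parity, so a word doubles as the list of parities of its
    arguments. *)
Lemma letter_hom b : ghom b (letter b). Proof. by case: b. Qed.

Lemma dstar_letter b (g : A) : dstar (letter b) g = if b then g else 0.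
Proof. by rewrite dstarE; case: b; rewrite /= ?opprK ?scale1r ?oppr0 ?scale0r. Qed.

Lemma wargs_hom n (w : word) (i : 'I_n.+1) :
  ghom ([ffun j : 'I_n.+1 => w j] i) (@wargs n w i).
Proof. by rewrite ffunE; apply: letter_hom. Qed.

Lemma rot_exp_wargs n (w : word) :
  odd (rot_exp [ffun j : 'I_n.+1 => w j]) = wrot_odd n w.
Proof.
rewrite /rot_exp oddM ffunE; congr (_ && _); first by case: (w n).
apply: (big_rec2 (fun x y => odd x = odd y)) => // i x y _ xy.
by rewrite !oddD xy ffunE; case: (w _).
Qed.

Lemma weval_local n (phi : cochain R n) : wlocal n.+1 (weval phi).
Proof. by move=> w w' h; congr (phi _); apply/funext => i; rewrite /wargs h. Qed.

Lemma weval_lambda n (phi : cochain R n) w :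
  weval (lambda phi) w = (-1) ^+ (n + wrot_odd n w) * weval phi (wrot n w).
Proof.
rewrite /weval (lambda_hom _ (@wargs_hom n w)) exprD.
rewrite -[_ ^+ rot_exp _]signr_odd rot_exp_wargs -exprD.
congr (_ * phi _); apply/funext => i; rewrite /rotate /wargs; congr letter.
rewrite /wrot /=; case: eqP => [->|/eqP i0].
  by rewrite add0n /= modn_small.
rewrite -lt0n in i0.
have -> : (i + n.+1).-1 = (i.-1 + n.+1)%N by lia.
by rewrite modnDr modn_small //; have := ltn_ord i; lia.
Qed.

(** For the derived product e is a left unit and u is a left annihilator: each product deletes its
    left factor or kills the term. In the wrap-around term only a last letter e survives, and it
    carries no Koszul sign. *)
Lemma weval_hochb n (phi : cochain R n) w :
  weval (hochb phi) w = wb n.+2 (weval phi) w.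
Proof.
rewrite /weval (hochb_hom _ (@wargs_hom n.+1 w)) /wb.
rewrite [RHS]big_ord_recr /=; congr (_ + _).
  apply: eq_bigr => i _; congr (_ * _).
  case wi: (w i); last first.
    rewrite mul0r; apply: (@cochain_zero _ _ _ _ i).
    by rewrite /Defs.merge ltnn eqxx /wargs dstar_letter /= wi.
  rewrite mul1r; congr (phi _); apply/funext => j.
  rewrite /Defs.merge /wargs /wdel /bump -val_eqE /=.
  case: (ltngtP j i) => // /val_inj ->.
  by rewrite dstar_letter wi.
case wn: (w n.+1); last first.
  rewrite mul0r (@cochain_zero _ _ _ _ ord0) ?mulr0 //.
  by rewrite /Defs.wrap eqxx /wargs dstar_letter /= wn.
rewrite mul1r exprD -[_ ^+ rot_exp _]signr_odd rot_exp_wargs wrot_odd_last // mulr1.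
congr (_ * phi _); apply/funext => j; rewrite /Defs.wrap /wargs /wdel /bump /=.
rewrite leqNgt ltn_ord add0n; case: eqP => // ->.
by rewrite dstar_letter /= wn.
Qed.

Lemma letter_decomp (f : A) :
  f = f.1 *: letter false + (- f.2) *: letter true.
Proof. by apply: grass_ext => /=; ring. Qed.

Lemma weval_inj n (phi psi : cochain R n) :
  (forall w, weval phi w = weval psi w) -> phi = psi.
Proof.
move=> h; apply/val_inj/funext => f.
(* Slots are expanded in the basis of letters one at a time; those below [k] are still arbitrary. *)
suff H k : (k <= n.+1)%N -> forall g : args R n,
    (forall i : 'I_n.+1, (k <= i)%N -> exists b, g i = letter b) ->
    phi g = psi g.
  by apply: (H n.+1) => // i; rewrite leqNgt ltn_ord.
elim: k {f} => [|k IH] kn g hg.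
  have [q hq] := boolp.choice (fun i => hg i isT).
  (* Beyond place [n], [inord] falls back to place 0; these letters are never read. *)
  have -> : g = @wargs n (fun k => q (inord k)).
    by apply/funext => i; rewrite hq /wargs inord_val.
  exact: h.
pose i := Ordinal kn.
have aux b : phi (upd g i (letter b)) = psi (upd g i (letter b)).
  apply: (IH (ltnW kn)) => j kj; rewrite /upd; case: eqP => [_|ji].
    by exists b.
  apply: hg; rewrite ltn_neqAle kj andbT; apply/eqP => E; apply: ji.
  exact: val_inj.
rewrite -(upd_id g i) (letter_decomp (g i)) !cochain_upd !cochain_updZ.
by rewrite !aux.
Qed.

Lemma cyclicP n (phi : cochain R n) : cyclic phi <-> wcyclic n (weval phi).
Proof.
split=> [cp w|h]; first by rewrite -weval_lambda cp.
by apply: weval_inj => w; rewrite weval_lambda h.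
Qed.

(** The basis dual to the letters. *)
Definition coord (b : bool) (f : A) : R := if b then - f.2 else f.1.

Lemma coord_letter b b' : coord b (letter b') = (b == b')%:R.
Proof. by case: b; case: b'; rewrite /= ?opprK ?oppr0. Qed.

Lemma coord_linear b a (u v : A) : coord b (a *: u + v) = a * coord b u + coord b v.
Proof. by case: b => /=; ring. Qed.

Definition wext_fun n (F : word -> R) : args R n -> R^o := fun f =>
  \sum_(p : {ffun 'I_n.+1 -> bool})
    F (fun k => p (inord k)) * \prod_i coord (p i) (f i).

Lemma wext_subproof n F : @wext_fun n F \in @multilinear_pred R n.
Proof.
apply/asboolP => i f a u v; rewrite /wext_fun mulr_sumr -big_split.
apply: eq_bigr => p _ /=; rewrite mulrCA -mulrDr; congr (_ * _).
have E x : \prod_j coord (p j) (upd f i x j) =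
    coord (p i) x * \prod_(j | j != i) coord (p j) (f j).
  rewrite (bigD1 i) //= {1}/upd eqxx; congr (_ * _).
  by apply: eq_bigr => j ji; rewrite /upd (negPf ji).
by rewrite !E coord_linear mulrDl mulrA.
Qed.

Definition wext n F : cochain R n := Cochain (wext_subproof n F).

Lemma weval_ext n F : wlocal n.+1 F -> weval (wext n F) =1 F.
Proof.
move=> locF w; rewrite /weval /= /wext_fun.
rewrite (bigD1 [ffun i : 'I_n.+1 => w i]) //= [X in _ + X]big1 ?addr0.
  rewrite big1 ?mulr1; last by move=> i _; rewrite ffunE coord_letter eqxx.
  by apply: locF => k kn; rewrite ffunE inordK.
move=> p; rewrite -subr_eq0 => /eqP pw.
have [i pi] : exists i, p i != w i.
  apply/existsP; rewrite -negb_forall; apply/negP => /forallP pE; apply: pw.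
  by apply/eqP; rewrite subr_eq0; apply/eqP/ffunP => i; rewrite ffunE; apply/eqP.
by rewrite (bigD1 i) //= coord_letter (negPf pi) mul0r mulr0.
Qed.

End Evaluation.

(** * Cohomology of the odd line *)

Section OddLine.
Variable R : realType.

Definition wtop : word := fun=> true.

(** On a cocycle the homotopy formula reads b K F = weight times F. The weight is unchanged by
    rotation and by deleting an e, so dividing K F by it keeps cyclicity and commutes with b. *)
Lemma cocycle_exact n (z : cochain R n) : cyclic z -> hochb z = 0 ->
  weval z wtop = 0 -> is_coboundary z.
Proof.
move=> /cyclicP cz bz ztop; set F := weval z in cz ztop.
have locF : wlocal n.+1 F by apply: weval_local.
have homF w : wb n.+1 (wK n F) w = (wweight n.+1 w)%:R * F w.
  rewrite -wb_wK [X in _ + X]big1 ?addr0 // => j _.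
  by rewrite -weval_hochb bz mulr0.
have F0 w : wweight n.+1 w = 0%N -> F w = 0.
  by move=> /wweight_eq0 wE; rewrite -ztop; apply: locF => k /wE.
case: n => [|n] in z bz F cz locF homF F0 ztop *.
  (* In degree 0 the sum defining K F is empty, so weight times [F] vanishes. *)
  apply: weval_inj => w; rewrite -/F [RHS](_ : _ = 0) //.
  have := homF w; rewrite [LHS]big1; last first.
    by move=> i _; rewrite /wK big_ord0 !mulr0.
  move=> /esym/eqP; rewrite mulf_eq0 pnatr_eq0 => /orP[/eqP/F0//|/eqP//].
(* At weight 0 the inverse is 0 by convention; there [F] vanishes as well. *)
pose G w : R := (wweight n.+1 w)%:R^-1 * wK n.+1 F w.
have locG : wlocal n.+1 G.
  move=> w w' ww'; rewrite /G /wweight /wK; congr (_%:R^-1 * _).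
    by apply: eq_bigr => i _; rewrite ww'.
  apply: eq_bigr => j _; congr (_ * _); apply: locF => k kn.
  have := ltn_ord j; rewrite /wins => jn.
  case: ifP => kj; first by apply: ww'; lia.
  by case: eqP => //= kj'; apply: ww'; lia.
exists (wext n G).
  apply/cyclicP => w; rewrite !weval_ext // /G wweight_rot mulrCA.
  by rewrite (wK_cyclic locF cz).
apply: weval_inj => w; rewrite weval_hochb -/(F w).
have -> : wb n.+2 (weval (wext n G)) w =
    (wweight n.+2 w)%:R^-1 * wb n.+2 (wK n.+1 F) w.
  rewrite mulr_sumr; apply: eq_bigr => i _; rewrite [RHS]mulrCA; congr (_ * _).
  rewrite weval_ext // /G; case wi: (w i); last by rewrite !mul0r mulr0.
  by rewrite !mul1r wweight_del // -ltnS.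
rewrite homF mulrA; have [/F0 ->|wt] := eqVneq (wweight n.+2 w) 0%N.
  by rewrite mulr0.
by rewrite mulVf ?mul1r // pnatr_eq0.
Qed.

(** Rotation fixes e...e with sign -1 in odd degree. *)
Lemma cyclic_wtop n (z : cochain R n) : odd n -> cyclic z -> weval z wtop = 0.
Proof.
move=> on /cyclicP/(_ wtop); rewrite wrot_odd_last // addn0 -signr_odd on.
have -> : wrot n wtop = wtop by apply/funext => -[].
rewrite expr1 mulN1r => /eqP; rewrite eq_sym -subr_eq0 opprK -mulr2n.
by rewrite mulrn_eq0 /= => /eqP.
Qed.

(** Every deletion turns e...e into a shorter e...e, of odd degree, where cyclic cochains vanish. *)
Lemma coboundary_wtop n (z : cochain R n) :
  ~~ odd n -> is_coboundary z -> weval z wtop = 0.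
Proof.
case: n z => [|n] z /=; first by move=> _ ->.
rewrite negbK => on [y cy <-]; rewrite weval_hochb /wb big1 // => i _.
rewrite (_ : wdel i wtop = wtop); last exact/funext.
by rewrite cyclic_wtop // !mulr0.
Qed.

Definition HC_top n (c : HC R n) : R := weval (cocycle_val (repr c)) wtop.

(** The choice made by [repr] is harmless: on e...e all cyclic cochains vanish in odd degree, and
    all coboundaries in even degree. *)
Lemma HC_topE n (z : cocycle R n) : HC_top (HC_class z) = weval z wtop.
Proof.
have cyc (x : cocycle R n) : cyclic (cocycle_val x).
  by have /asboolP[] := cocycleP x.
rewrite /HC_top; set y := repr _.
have [on|en] := boolP (odd n); first by rewrite !cyclic_wtop.
have /HC_classE/(coboundary_wtop en)/eqP : HC_class y = HC_class z.
  by rewrite {1}/HC_class reprK.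
by rewrite -[weval _ _]/(weval y wtop - weval z wtop) subr_eq0 => /eqP.
Qed.

Lemma HC_top_inj n (c : HC R n) : HC_top c = 0 -> c = 0.
Proof.
have [z ->] := HC_class_ex c; rewrite HC_topE => ztop.
have -> : 0 = HC_class (0 : cocycle R n) by rewrite /HC_class raddf0.
apply/HC_classE; rewrite -[cocycle_val 0]/(0 : cochain R n) subr0.
by have /asboolP[cz bz] := cocycleP z; apply: cocycle_exact.
Qed.

(** For even [n], e...e consists of n+1 odd elements, so its total standard parity is odd. *)
Lemma HC_top_even n (c : HC R n) : HC_part false c -> HC_top c = 0.
Proof.
move=> [z zp ->]; rewrite HC_topE.
have [on|en] := boolP (odd n).
  by have /asboolP[cz _] := cocycleP z; apply: cyclic_wtop.
apply: (zp xpredT); first by move=> i; apply: letter_hom.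
by rewrite sum_nat_const card_ord muln1 /= en.
Qed.

Lemma HC_top_surj n (a : R) : ~~ odd n -> exists c : HC R n, HC_top c = a.
Proof.
(* The cocycle is supported on e...e, the only word of weight 0. *)
move=> en; pose F (w : word) : R := a * (wweight n.+1 w == 0%N)%:R.
have locF : wlocal n.+1 F.
  move=> w w' ww'; rewrite /F /wweight; congr (_ * (_ == _)%:R).
  by apply: eq_bigr => i _; rewrite ww'.
have Fcyc : cyclic (wext n F).
  apply/cyclicP => w; rewrite !weval_ext // /F wweight_rot.
  have [/wweight_eq0 wE|_] := eqVneq (wweight n.+1 w) 0%N; last by rewrite !mulr0.
  by rewrite wrot_odd_last ?wE // addn0 -signr_odd (negPf en) mul1r.
have Fcoc : hochb (wext n F) = 0.
  apply: weval_inj => w; rewrite weval_hochb [RHS](_ : _ = 0) //.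
  have [/wweight_eq0 wE|wt] := eqVneq (wweight n.+2 w) 0%N; last first.
    rewrite /wb big1 // => i _; rewrite weval_ext // /F.
    case wi: (w i); last by rewrite mul0r mulr0.
    have im : (i <= n.+1)%N by rewrite -ltnS.
    by rewrite wweight_del // (negPf wt) !mulr0.
  transitivity (weval (hochb (wext n F)) wtop).
    by rewrite -weval_hochb; apply: weval_local => k /wE.
  rewrite weval_hochb /wb.
  under eq_bigr do rewrite (_ : wdel _ wtop = wtop) // mul1r.
  rewrite -mulr_suml.
  (* On e...e the coboundary is an alternating sum of n+2 equal terms, an even number. *)
  rewrite [in LHS](_ : \sum_i _ = (odd n.+2)%:R); first by rewrite /= en mul0r.
  elim: n.+2 => [|m IH]; first by rewrite big_ord0.
  rewrite big_ord_recr IH -signr_odd /=.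
  by case: odd; rewrite ?expr1 ?expr0 ?subrr ?add0r.
have Fin : wext n F \in @cocycle_pred R n by apply/asboolP.
exists (HC_class (Cocycle Fin)); rewrite HC_topE.
rewrite -[LHS]/(weval (wext n F) wtop) weval_ext // /F.
by rewrite (_ : wweight _ _ = 0%N) ?eqxx ?mulr1 // /wweight big1.
Qed.

Lemma HC_top_linear n a (u v : HC R n) :
  HC_top (a *: u + v) = a * HC_top u + HC_top v.
Proof.
have [x ->] := HC_class_ex u; have [y ->] := HC_class_ex v.
rewrite -[a *: HC_class x]HC_classZ -HC_classD !HC_topE.
by [].
Qed.

Section Iso.
Variables n k : nat.

(** The constant row treats both parities of the degree at once: it has one entry for [k = 1] and
    none for [k = 0]. *)
Definition HC_map (c : HC R n) : 'rV[R]_0 * 'rV[R]_k := (0, const_mx (HC_top c)).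

Lemma HC_map_linear : linear HC_map.
Proof.
move=> a u v; rewrite /HC_map HC_top_linear; congr pair => /=.
  by rewrite scaler0 addr0.
by apply/rowP => i; rewrite !mxE.
Qed.

HB.instance Definition _ :=
  GRing.isLinear.Build R (HC R n) ('rV[R]_0 * 'rV[R]_k)%type _ HC_map HC_map_linear.

End Iso.

Lemma HC_super_iso n : super_iso (HC_super R n) (rsuper R 0 (~~ odd n)).
Proof.
pose h : {linear HC_super R n -> rsuper R 0 (~~ odd n)} := @HC_map n (~~ odd n).
have h_inj (c : HC R n) : h c = 0 -> c = 0.
  move=> hc; apply: HC_top_inj; have [on|en] := boolP (odd n).
    have [z ->] := HC_class_ex c; rewrite HC_topE.
    by have /asboolP[cz _] := cocycleP z; apply: cyclic_wtop.
  have : (h c).2 = 0 by rewrite hc.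
  rewrite /h /= en.
  by move=> /rowP/(_ ord0); rewrite !mxE.
have h_surj (y : rsuper R 0 (~~ odd n)) : exists c, h c = y.
  case: y => y1 y2; rewrite /h /= /HC_map.
  case/orP: (orbN (odd n)) => [on|en].
    exists 0; rewrite [y1]thinmx0; congr pair.
    by apply/rowP => -[i i0]; exfalso; rewrite on in i0.
  (* The width is generalized because [~~ odd n] equals 1 only propositionally. *)
  have const k (x : 'rV[R]_k) : k = 1%N -> exists a, x = const_mx a.
    move=> k1; move: x; rewrite k1 => x; exists (x 0 0).
    by apply/rowP => i; rewrite mxE ord1.
  have [a ->] : exists a, y2 = const_mx a by apply: const; rewrite en.
  by have [c <-] := HC_top_surj a en; exists c; rewrite [y1]thinmx0.
have [g gK] := boolp.choice h_surj.
exists h; split.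
  exists g => // c; apply/eqP; rewrite -subr_eq0; apply/eqP/h_inj.
  by rewrite linearB /= gK subrr.
have even0 (c : HC R n) : HC_part false c -> h c = 0.
  move=> /HC_top_even c0; rewrite /h /= /HC_map c0.
  by congr pair; apply/rowP => i; rewrite !mxE.
move=> [] c; split=> /=.
- by rewrite /HC_map.
(* Every class is odd, since [h] is injective and kills its even component. *)
- move=> _; have [u [w [/even0/h_inj -> wodd ->]]] := HC_part_sum c.
  by rewrite add0r.
- by move=> /even0 hc; apply: (congr1 snd hc).
- move=> hc; rewrite (h_inj c); first exact: HC_part0.
  by rewrite /h /HC_map /=; congr pair.
Qed.

End OddLine.

Theorem theorem3p2 (R : realType) (n : nat) :
  super_iso (HC_super R n) (if odd n then rsuper R 0 0 else rsuper R 0 1).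
Proof. by have := HC_super_iso R n; case: odd. Qed.
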